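(* Fix $\alpha\in(0,1)$ and $K\ge1$. Let $\phi:[0,\infty]\to[0,\infty]$ be an increasing transform. If the e-testing procedure $\mathcal G(\phi)$ satisfies $$\mathbb E\left[\frac{F_{\mathcal G(\phi)}}{R_{\mathcal G(\phi)}}\right]\le\alpha$$ for arbitrary configurations of e-values (that is, for every probability space, every set $\mathcal N\subseteq\mathcal K$ of true null indices and every $[0,\infty]^K$-valued random vector $(E_1,\dots,E_K)$ with $\mathbb E[E_k]\le1$ for all $k\in\mathcal N$), then $\mathcal G(\phi)\subseteq\mathcal G(\alpha)$, i.e. for every input $(e_1,\dots,e_K)\in[0,\infty]^K$, every hypothesis rejected by $\mathcal G(\phi)$ is also rejected by the base e-BH procedure $\mathcal G(\alpha)$.
   Context: $\mathcal K=\{1,\dots,K\}$. An increasing transform is a strictly increasing and continuous function $\phi:[0,\infty]\to[0,\infty]$ with $\phi(\infty)=\infty$ and $\phi(0)<1$. For $e_1,\dots,e_K\in[0,\infty]$ let $e_{[1]}\ge\dots\ge e_{[K]}$ be the order statistics from largest to smallest. The procedure $\mathcal G(\phi)$ rejects the hypotheses with the $k^*_{e,\phi}$ largest e-values, where $k^*_{e,\phi}=\max\{k\in\mathcal K:k\phi(e_{[k]})/K\ge1\}$, with $\max\varnothing=0$. The base e-BH procedure $\mathcal G(\alpha)$ is the one with $\phi(t)=\alpha t$, i.e. it rejects the hypotheses with the $k_e^*$ largest e-values, $k_e^*=\max\{k\in\mathcal K:ke_{[k]}/K\ge1/\alpha\}$. $R_{\mathcal G}$ is the number of rejected hypotheses,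 $F_{\mathcal G}$ the number of rejected hypotheses with index in $\mathcal N$, and $0/0=0$. *)

(* Defs.v *)
From HB Require Import structures.
From mathcomp Require Export all_boot all_order all_algebra.
From mathcomp Require Export all_classical all_reals all_analysis.
From mathcomp Require Export measurable_realfun.

Set Implicit Arguments.
Unset Strict Implicit.
Unset Printing Implicit Defensive.

Import Order.TTheory GRing.Theory Num.Theory.
Local Open Scope ring_scope.
Local Open Scope ereal_scope.

(* A transform of [0,+oo] is a total map on \bar R of which only the values on
   the nonnegative half matter. *)
Definition increasing_transform (R : realType) (phi : \bar R -> \bar R) : Prop :=
  [/\ forall x, 0 <= x -> 0 <= phi x,
      forall x y, 0 <= x -> x < y -> phi x < phi y,
      {within [set x : \bar R | 0 <= x], continuous phi}%classic,
      phi +oo = +oo & phi 0 < 1].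

(* The k-th largest of the e_i, for 1 <= k <= K. *)
Definition order_stat (R : realType) (K : nat) (e : 'I_K -> \bar R) (k : nat)
  : \bar R := nth 0 (sort (fun x y => y <= x) [seq e i | i <- enum 'I_K]) k.-1.

Definition kstar (R : realType) (K : nat) (phi : \bar R -> \bar R)
  (e : 'I_K -> \bar R) : nat :=
  (\max_(k < K.+1 | (0 < k)%N &&
           (1 <= k%:R%:E * phi (order_stat e k) / K%:R%:E)%E) k)%N.

(* The hypotheses with the [kstar] largest e-values. Comparing with the
   threshold [order_stat e (kstar phi e)] is unambiguous: no e-value ranked
   below it can tie with it; see [card_eproc]. *)
Definition eproc (R : realType) (K : nat) (phi : \bar R -> \bar R)
  (e : 'I_K -> \bar R) : {set 'I_K} :=
  [set i | (0 < kstar phi e)%N && (order_stat e (kstar phi e) <= e i)]%SET.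

Definition ebh (R : realType) (K : nat) (alpha : R) (e : 'I_K -> \bar R)
  : {set 'I_K} := eproc (fun t => alpha%:E * t) e.

(* F / R, with 0 / 0 = 0 by the convention x / 0 = 0. *)
Definition FDP (R : realType) (K : nat) (N D : {set 'I_K}) : R :=
  (#|D :&: N|%:R / #|D|%:R)%R.

Definition controls_FDR (R : realType) (K : nat)
  (G : ('I_K -> \bar R) -> {set 'I_K}) (alpha : R) : Prop :=
  forall (d : measure_display) (T : measurableType d) (P : probability T R)
    (N : {set 'I_K}) (E : 'I_K -> T -> \bar R),
    (forall k, measurable_fun setT (E k)) ->
    (forall k w, 0 <= E k w) ->
    (forall k, k \in N -> \int[P]_w E k w <= 1) ->
    'E_P[fun w => FDP R N (G (fun k => E k w))] <= alpha%:E.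

Section CardEproc.
Context (R : realType) (K : nat) (phi : \bar R -> \bar R) (e : 'I_K -> \bar R).

Let s := sort (fun x y => y <= x) [seq e i | i <- enum 'I_K].

Let size_s : size s = K.
Proof. by rewrite /s size_sort size_map size_enum_ord. Qed.

Let sorted_s : sorted (fun x y => y <= x) s.
Proof. by apply: sort_sorted => x y; exact: le_total. Qed.

Lemma kstarP : (0 < kstar phi e)%N ->
  (kstar phi e <= K)%N /\
  1 <= (kstar phi e)%:R%:E * phi (order_stat e (kstar phi e)) / K%:R%:E.
Proof.
rewrite /kstar; pose P (k : 'I_K.+1) :=
  (0 < k)%N && (1 <= k%:R%:E * phi (order_stat e k) / K%:R%:E)%E.
case: (pickP P) => [k0 Pk0 _|P0]; last by rewrite (big_pred0 _ _ _ _ P0).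
have P_gt0 : (0 < #|P|)%N by apply/card_gt0P; exists k0.
rewrite (_ : (\max_(k < K.+1 | _) k)%N = (\max_(k in P) k)%N) //.
have [k Pk ->] := eq_bigmax_cond (fun k : 'I_K.+1 => k : nat) P_gt0.
by move: Pk; rewrite unfold_in /P => /andP[_ ->]; rewrite -ltnS ltn_ord.
Qed.

Lemma kstar_max (k : nat) : (0 < k <= K)%N ->
  1 <= k%:R%:E * phi (order_stat e k) / K%:R%:E -> (k <= kstar phi e)%N.
Proof.
move=> /andP[k0 kK] h; have kK1 : (k < K.+1)%N by [].
by apply: (@leq_bigmax_cond _ _ (fun k : 'I_K.+1 => k : nat) (Ordinal kK1));
  rewrite /= k0.
Qed.

Lemma card_eproc : (forall i, 0 <= e i) ->
  (forall x, 0 <= x -> 0 <= phi x) ->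
  #|eproc phi e| = kstar phi e.
Proof.
move=> e0 phi0; rewrite /eproc.
have [k0|kpos] := posnP (kstar phi e).
  by rewrite k0; apply: eq_card0 => i; rewrite inE.
have [kK hk] := kstarP kpos.
set k := kstar phi e in kpos kK hk *; set t := order_stat e k.
have tr : transitive (fun x y : \bar R => y <= x).
  by move=> y x z yx zy; exact: le_trans zy yx.
have -> : #|[set i | true && (t <= e i)]%SET| =
    count (fun x => t <= x) s.
  rewrite (permP (permEl (perm_sort _ _))) count_map cardE.
  by rewrite size_filter -enumT; apply: eq_count => i; rewrite /= inE.
have top j : (j < k)%N -> t <= nth 0 s j.
  move=> jk; have kk : (k.-1 < K)%N by rewrite prednK.
  apply: (sorted_leq_nth tr _ 0 sorted_s) => //=; rewrite ?inE ?size_s //.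
  - exact: leq_trans jk kK.
  - by rewrite -ltnS prednK.
have bot j : (k <= j < K)%N -> nth 0 s j < t.
  move=> /andP[kj jK]; have kK' : (k < K)%N by exact: leq_ltn_trans jK.
  have h1 : nth 0 s j <= nth 0 s k.
    by apply: (sorted_leq_nth tr _ 0 sorted_s) => //=; rewrite ?inE ?size_s.
  apply: (le_lt_trans h1); rewrite ltNge; apply/negP => h2.
  have tk : nth 0 s k = t.
    apply/eqP; rewrite eq_le h2 andbT.
    have kk : (k.-1 < K)%N by rewrite prednK.
    apply: (sorted_leq_nth tr _ 0 sorted_s) => //=; rewrite ?inE ?size_s //.
    exact: leq_pred.
  suff : (k.+1 <= kstar phi e)%N by rewrite -/k ltnn.
  apply: kstar_max => //.
  rewrite [order_stat _ _]tk; apply: (le_trans hk).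
  have t0 : 0 <= t.
    have : t \in s by apply: mem_nth; rewrite size_s prednK.
    by rewrite mem_sort => /mapP[i _ ->].
  have K0 : (0 < K)%N := leq_trans kpos kK.
  rewrite inver pnatr_eq0 (gtn_eqF K0).
  apply: lee_wpmul2r; first by rewrite lee_fin invr_ge0.
  apply: lee_wpmul2r; first exact: phi0.
  by rewrite lee_fin ler_nat.
rewrite -(cat_take_drop k s) count_cat.
have -> : count (fun x => t <= x) (take k s) = k.
  rewrite -[RHS](_ : size (take k s) = k); last by rewrite size_takel ?size_s.
  apply/eqP; rewrite -all_count; apply/(all_nthP 0) => j.
  rewrite size_takel ?size_s // => jk; rewrite nth_take //; exact: top.
rewrite (_ : count _ (drop k s) = 0%N) ?addn0 //.
apply/eqP; rewrite -leqn0 leqNgt -has_count; apply/negP => /(has_nthP 0)[j].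
rewrite size_drop size_s => jK; rewrite nth_drop leNgt bot //.
by rewrite leq_addr /= -ltn_subRL.
Qed.

End CardEproc.

(* Main.v *)
From HB Require Import structures.
Require Import Defs.

Import Order.TTheory GRing.Theory Num.Theory.
Local Open Scope ring_scope.
Local Open Scope ereal_scope.

(** The contrapositive is an adversarial example. If [phi] accepts rank k at a finite level r > 0,
    let all K hypotheses be null, pick k of them uniformly at random up to cyclic shift, and give
    them the e-value r with probability p. Each mean is p k r / K, so p = min(1, K / (k r)) is
    admissible. On that event something is rejected and every rejection is false, so the FDR is at
    least p ([FDR_lower_bound]). Control at level [alpha] < 1 then forces K / (k r) <= [alpha],
    which is the e-BH criterion at rank k. With k the number of rejections by [phi] and r the k-th
    largest e-value, base e-BH rejects at least as many hypotheses. *)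

Lemma finite_support_probability (R : realType) (m : nat) (w : nat -> {nonneg R}) :
  (\sum_(j < m) (w j)%:num = 1)%R ->
  exists P : probability nat R, forall f : nat -> \bar R, (forall x, 0 <= f x) ->
    \int[P]_x f x = \sum_(j < m) (w j)%:num%:E * f j.
Proof.
move=> w1; pose mu : {measure set nat -> \bar R} :=
  msum (fun j => mscale (w j) (\d_j)) m.
have mu1 : mu setT = 1.
  rewrite /mu /= /msum /= /mscale /=.
  under eq_bigr do rewrite diracT mule1.
  by rewrite sumEFin w1.
pose P : probability nat R :=
  HB.pack (Measure.sort mu) (Measure_isProbability.Build _ _ _ mu mu1).
exists P => f f0.
rewrite [LHS](_ : _ = \int[mu]_x f x) // ge0_integral_measure_sum //.
apply: eq_bigr => j _.
rewrite ge0_integral_mscale // integral_dirac // diracT mul1e //.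
Qed.

(** If the k-th entry of the decreasing list were below [t], so would all later ones be, leaving at
    most k - 1 entries that reach [t]. *)
Lemma order_stat_ge (R : realType) (K k : nat) (e : 'I_K -> \bar R) (t : \bar R) :
  (0 < k)%N -> (k <= #|[set i | (t <= e i)%E]%SET|)%N -> t <= order_stat e k.
Proof.
move=> k0 kt; rewrite /order_stat leNgt; apply/negP => lt_t.
set s := sort _ _ in lt_t.
have size_s : size s = K by rewrite /s size_sort size_map size_enum_ord.
have sorted_s : sorted (fun x y : \bar R => y <= x) s.
  by apply: sort_sorted => x y; exact: le_total.
have tr : transitive (fun x y : \bar R => y <= x).
  by move=> y x z yx zy; exact: le_trans zy yx.
have card_s : #|[set i | t <= e i]%SET| = count (fun x => t <= x) s.
  rewrite (permP (permEl (perm_sort _ _))) count_map cardE.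
  by rewrite size_filter -enumT; apply: eq_count => i; rewrite /= inE.
move: kt; rewrite card_s -(cat_take_drop k.-1 s) count_cat.
rewrite [X in (_ + X)%N](_ : _ = 0%N) ?addn0.
  move=> h; have := leq_trans h (count_size _ _).
  rewrite size_take_min leq_min => /andP[+ _].
  by case: k k0 {h lt_t} => // k _; rewrite ltnn.
apply/eqP; rewrite -leqn0 leqNgt -has_count; apply/negP => /(has_nthP 0)[j].
rewrite size_drop size_s => jK; rewrite nth_drop leNgt => /negP; apply.
apply: le_lt_trans lt_t.
have h : (k.-1 + j < K)%N by rewrite -ltn_subRL.
apply: (sorted_leq_nth tr _ 0 sorted_s) => //=; rewrite ?inE ?size_s ?leq_addr //.
exact: leq_ltn_trans (leq_addr _ _) h.
Qed.

Lemma order_stat_anti (R : realType) (K k l : nat) (e : 'I_K -> \bar R) :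
  (0 < k)%N -> (k <= l <= K)%N -> order_stat e l <= order_stat e k.
Proof.
move=> k0 /andP[kl lK]; rewrite /order_stat.
have l0 := leq_trans k0 kl.
apply: (sorted_leq_nth (leT := fun x y : \bar R => y <= x)) => //=.
- by move=> y x z yx zy; exact: le_trans zy yx.
- by apply: sort_sorted => x y; exact: le_total.
- by rewrite inE size_sort size_map size_enum_ord prednK// (leq_trans kl).
- by rewrite inE size_sort size_map size_enum_ord prednK.
- by rewrite -ltnS !prednK.
Qed.

(** Translation is injective on the cyclic group ['I_n.+1]. This serves twice below: to count the
    shifts that favour a given hypothesis, and the hypotheses favoured by a given shift. *)
Lemma card_shift (n : nat) (D : {set 'I_n.+1}) (i : 'I_n.+1) :
  #|[set j | (i + j)%R \in D]%SET| = #|D|.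
Proof.
by rewrite -[RHS](card_preimset D (@addrI _ i)); apply: eq_card => j; rewrite !inE.
Qed.

(* All hypotheses are null; with probability [p] a uniformly random cyclic shift of
   a [k]-element set receives the value [r], and otherwise all e-values are [0]. The
   largest [p] allowed by the constraint on the means is [min 1 ((n + 1) / (k r))],
   and the FDP is [1] on this event. *)
Lemma FDR_lower_bound (R : realType) (alpha r : R) (n k : nat)
    (phi : \bar R -> \bar R) :
  (forall x, 0 <= x -> 0 <= phi x) ->
  (forall x y, 0 <= x -> x <= y -> phi x <= phi y) ->
  controls_FDR (@eproc R n.+1 phi) alpha ->
  (0 < r)%R -> (0 < k <= n.+1)%N ->
  1 <= k%:R%:E * phi r%:E / n.+1%:R%:E ->
  (Num.min 1 (n.+1%:R / (k%:R * r)) <= alpha)%R.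
Proof.
move=> phi0 phi_le fdr r0 /andP[k0 kn] hk.
set p := Num.min _ _.
have kR : (0 < k%:R :> R)%R by rewrite ltr0n.
have p0 : (0 <= p)%R by rewrite le_min ler01 /= divr_ge0 ?mulr_ge0 ?ltW.
have p1 : (p <= 1)%R by rewrite ge_min lexx.
have pk : (p * (k%:R * r) <= n.+1%:R)%R.
  by rewrite -ler_pdivlMr ?mulr_gt0// ge_min lexx orbT.
have [D cardD] : exists D : {set 'I_n.+1}, #|D| = k.
  exists (widen_ord kn @: [set: 'I_k])%SET; rewrite card_imset ?cardsT ?card_ord//.
  by move=> x y xy; apply: val_inj; exact: (congr1 val xy).
have pn0 : (0 <= p / n.+1%:R)%R by rewrite divr_ge0.
have q0 : (0 <= 1 - p)%R by rewrite subr_ge0.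
(* Outcomes below [n.+1] are the shifts, sharing mass [p] equally; outcome [n.+1] carries the
   remaining mass and makes all e-values 0. *)
pose w (j : nat) : {nonneg R} :=
  if (j < n.+1)%N then NngNum pn0 else NngNum q0.
have [P intP] : exists P : probability nat R,
    forall f : nat -> \bar R, (forall x, 0 <= f x) ->
    \int[P]_x f x = \sum_(j < n.+2) (w j)%:num%:E * f j.
  apply: finite_support_probability.
  rewrite big_ord_recr /= {2}/w ltnn /=.
  under eq_bigr => j _ do rewrite /w ltn_ord /=.
  by rewrite sumr_const card_ord -(mulr_natr (p / _)) divfK ?pnatr_eq0// addrC subrK.
pose E (i : 'I_n.+1) (j : nat) : \bar R :=
  if (j < n.+1)%N && ((i + inord j)%R \in D) then r%:E else 0.
have E0 i j : 0 <= E i j by rewrite /E; case: ifP => // _; rewrite lee_fin ltW.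
(* Exactly k of the shifts move [i] into [D], so the mean is p k r / (n + 1), at most 1 by [pk]. *)
have meanE i : \int[P]_x E i x <= 1.
  rewrite intP // big_ord_recr /= {2}/E ltnn /= mule0 adde0.
  rewrite (eq_bigr (fun j : 'I_n.+1 =>
    (if (i + j)%R \in D then p / n.+1%:R * r else 0)%R%:E)); last first.
    move=> j _; rewrite /w /E /= ltn_ord /= inord_val.
    by case: ifP => _; rewrite ?mule0.
  rewrite sumEFin lee_fin -big_mkcond sumr_const /=.
  have -> : #|[pred j | (i + j)%R \in D]| = k.
    by rewrite -cardD -(card_shift _ D i); apply: eq_card => j; rewrite !inE.
  rewrite -[(_ *+ k)%R]mulr_natr (mulrAC p) (mulrAC (p * r)%R).
  by rewrite ler_pdivrMr ?ltr0n// mul1r -mulrA (mulrC r).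
(* The sigma-algebra on [nat] is discrete. *)
have mE i : measurable_fun setT (E i) by [].
have := fdr _ _ P [set: 'I_n.+1]%SET E mE E0 (fun i _ => meanE i).
rewrite unlock intP => [main|x]; last by rewrite lee_fin /FDP divr_ge0.
rewrite -lee_fin; apply: le_trans main.
rewrite big_ord_recr /=; apply: le_trans (leeDl _ _); last first.
  by rewrite mule_ge0 // lee_fin /FDP divr_ge0.
rewrite (eq_bigr (fun j : 'I_n.+1 => (p / n.+1%:R)%R%:E)).
  by rewrite sumEFin sumr_const card_ord -(mulr_natr (p / _)) divfK ?pnatr_eq0.
(* All hypotheses are null, so the FDP is 1 as soon as the rejection set is nonempty; under a shift,
   k e-values equal [r], hence at least k rejections. *)
move=> j _; rewrite /w ltn_ord /= /FDP finset.setIT divff ?mule1//.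
rewrite pnatr_eq0 card_eproc // -lt0n (leq_trans k0)//.
apply: kstar_max; first by rewrite k0.
have le_r : r%:E <= order_stat (E^~ j) k.
  apply: order_stat_ge => //; rewrite -cardD -(card_shift _ D j).
  apply/subset_leq_card/fintype.subsetP => i; rewrite !inE => ij.
  by rewrite /E ltn_ord /= inord_val addrC ij.
apply: (le_trans hk); rewrite inver pnatr_eq0 /=.
apply: lee_wpmul2r; first by rewrite lee_fin invr_ge0.
apply: lee_wpmul2l; first by rewrite lee_fin.
by apply: phi_le => //; rewrite lee_fin ltW.
Qed.

Theorem theorem5 (R : realType) (alpha : R) (K : nat) (phi : \bar R -> \bar R)
  (halpha : (0 < alpha < 1)%R) (hK : (1 <= K)%N)
  (hphi : increasing_transform phi)
  (hFDR : controls_FDR (@eproc R K phi) alpha) :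
  forall e : 'I_K -> \bar R, (forall k, (0 <= e k)%E) ->
    eproc phi e \subset ebh alpha e.
Proof.
move: halpha => /andP[a0 a1] e e0.
case: hphi => phi0 phi_lt _ _ phi01.
have phi_le x y : 0 <= x -> x <= y -> phi x <= phi y.
  by move=> x0; rewrite le_eqVlt => /predU1P[->//|/phi_lt h]; exact/ltW/h.
apply/fintype.subsetP => i; rewrite !inE => /andP[kpos ei].
have [kK hk] := kstarP kpos.
set k := kstar phi e in kpos kK hk ei *; set t := order_stat e k in hk ei *.
(* A larger number of rejections means a lower threshold, so comparing the counts is enough. *)
suff h : (k <= kstar (fun t => alpha%:E * t)%E e)%N.
  have h0 := leq_trans kpos h; rewrite h0 /=.
  apply: le_trans ei; apply: order_stat_anti => //.
  by rewrite h (kstarP h0).1.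
apply: kstar_max; first by rewrite kpos.
rewrite -/t.
have t0 : 0 <= t.
  have : t \in sort (fun x y => y <= x) [seq e i | i <- enum 'I_K].
    by apply: mem_nth; rewrite size_sort size_map size_enum_ord prednK.
  by rewrite mem_sort => /mapP[j _ ->].
case: K => [|n] in e e0 i hK hFDR k t kpos kK hk ei t0 *; first by [].
have kR : (0 < k%:R :> R)%R by rewrite ltr0n.
have nR : (0 < n.+1%:R :> R)%R by rewrite ltr0n.
(* An infinite [t] meets the e-BH criterion outright; the example needs a finite level. *)
clearbody t; case: t => [r||] // in ei hk t0 *; last first.
  rewrite inver gt_eqF//= gt0_muley ?lte_fin// gt0_muley ?lte_fin//.
  by rewrite gt0_mulye ?lte_fin ?invr_gt0// leey.
(* At level 0 the criterion would fail, since [phi 0 < 1] and k <= K. *)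
have r0 : (0 < r)%R.
  rewrite lt_neqAle -lee_fin t0 andbT; apply/eqP => r0; move: hk; rewrite -r0.
  rewrite leNgt => /negP; apply; move: phi01 (phi0 0 (lexx _)).
  case: (phi 0) => // x; rewrite lte_fin lee_fin => x1 x0.
  rewrite inver gt_eqF//= lte_fin ltr_pdivrMr// mul1r.
  apply: (@le_lt_trans _ _ (n.+1%:R * x)%R).
    by rewrite ler_wpM2r// ler_nat.
  by rewrite gtr_pMr.
have := FDR_lower_bound _ _ _ _ _ _ phi0 phi_le hFDR r0 _ hk.
(* As [alpha] < 1, the bound on the minimum must come from its second argument. *)
rewrite kpos kK => /(_ isT); rewrite ge_min leNgt a1 /=.
rewrite ler_pdivrMr ?mulr_gt0// => h.
by rewrite inver gt_eqF//= lee_fin ler_pdivlMr// mul1r mulrCA.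
Qed.
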